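(* Let $f,f^\nu:\mathbb{R}^m\times\mathbb{R}^n\to\overline{\mathbb{R}}$, $\nu\in\mathbb{N}$, be Rockafellians (for functions $\phi,\phi^\nu:\mathbb{R}^n\to\overline{\mathbb{R}}$, respectively). Suppose that $f^\nu$ epi-converges to $f$ and $y^\nu\to y\in\mathbb{R}^m$. If for every convergent sequence $\{x^\nu\in\mathbb{R}^n,\nu\in\mathbb{N}\}$ the sequence of functions $\{f^\nu_{y^\nu}(\cdot,x^\nu),\nu\in\mathbb{N}\}$ on $\mathbb{R}^m$ is tight, then $l^\nu(\cdot,y^\nu)$ epi-converges to $l(\cdot,y)$.
   Context: $\overline{\mathbb{R}}=[-\infty,\infty]$, $\mathbb{N}=\{1,2,\dots\}$. A function $f:\mathbb{R}^m\times\mathbb{R}^n\to\overline{\mathbb{R}}$ is a Rockafellian for $g:\mathbb{R}^n\to\overline{\mathbb{R}}$ when $f(0,x)=g(x)$ for all $x$. For $y\in\mathbb{R}^m$: $f_y(u,x)=f(u,x)-\langle y,u\rangle$, $f^\nu_y(u,x)=f^\nu(u,x)-\langle y,u\rangle$. Lagrangians: $l(x,y)=\inf_{u\in\mathbb{R}^m}\{f(u,x)-\langle y,u\rangle\}$ and $l^\nu(x,y)=\inf_{u\in\mathbb{R}^m}\{f^\nu(u,x)-\langle y,u\rangle\}$. Epi-convergence: $g^\nu:\mathbb{R}^d\to\overline{\mathbb{R}}$ epi-converge to $g:\mathbb{R}^d\to\overline{\mathbb{R}}$ when (i) $\liminf g^\nu(x^\nu)\ge g(x)$ whenever $x^\nu\to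 x$, and (ii) for every $x$ there is $x^\nu\to x$ with $\limsup g^\nu(x^\nu)\le g(x)$. Tightness: $\{g^\nu:\mathbb{R}^d\to\overline{\mathbb{R}},\nu\in\mathbb{N}\}$ is tight if for all $\epsilon>0$ there exist a compact set $B_\epsilon\subset\mathbb{R}^d$ and $\nu_\epsilon\in\mathbb{N}$ such that $\inf\{g^\nu(x)\mid x\in B_\epsilon\}\le\inf g^\nu+\epsilon$ for all $\nu\ge\nu_\epsilon$. *)

(* Defs.v *)
From HB Require Import structures.
From mathcomp Require Import all_boot all_order all_algebra.
From mathcomp Require Import all_classical all_reals all_analysis.
Import Order.TTheory GRing.Theory Num.Theory.
Import numFieldNormedType.Exports.

Set Implicit Arguments.
Unset Strict Implicit.
Unset Printing Implicit Defensive.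

Local Open Scope classical_set_scope.
Local Open Scope ring_scope.
Local Open Scope ereal_scope.

Definition rockafellian (R : realType) (m n : nat)
    (f : 'rV[R]_m * 'rV[R]_n -> \bar R) (g : 'rV[R]_n -> \bar R) : Prop :=
  forall x, f (0%R, x) = g x.

Definition dotp (R : realType) (m : nat) (y u : 'rV[R]_m) : R :=
  (\sum_(i < m) y ord0 i * u ord0 i)%R.

(* [tilt f y] is f_y : (u, x) |-> f(u, x) - <y, u>. *)
Definition tilt (R : realType) (m n : nat)
    (f : 'rV[R]_m * 'rV[R]_n -> \bar R) (y : 'rV[R]_m) :
    'rV[R]_m * 'rV[R]_n -> \bar R :=
  fun p => f p - (dotp y p.1)%:E.

Definition lagrangian (R : realType) (m n : nat)
    (f : 'rV[R]_m * 'rV[R]_n -> \bar R) (x : 'rV[R]_n) (y : 'rV[R]_m) :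
    \bar R :=
  ereal_inf [set f (u, x) - (dotp y u)%:E | u in [set: 'rV[R]_m]].

(* Stated on a topological space T so as to apply both to R^n and to
   R^m * R^n with its product topology. *)
Definition epi_converges (R : realType) (T : topologicalType)
    (g_ : nat -> T -> \bar R) (g : T -> \bar R) : Prop :=
  (forall (x_ : nat -> T) (x : T), x_ @ \oo --> x ->
     g x <= limn_einf (fun nu => g_ nu (x_ nu))) /\
  (forall x : T, exists2 x_ : nat -> T, x_ @ \oo --> x &
     limn_esup (fun nu => g_ nu (x_ nu)) <= g x).

Definition tight (R : realType) (d : nat)
    (g_ : nat -> 'rV[R]_d -> \bar R) : Prop :=
  forall e : R, (0 < e)%R ->
    exists (B : set 'rV[R]_d) (N : nat), compact B /\
      forall nu, (N <= nu)%N ->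
        ereal_inf [set g_ nu x | x in B] <=
        ereal_inf [set g_ nu x | x in [set: 'rV[R]_d]] + e%:E.

(* Main.v *)
(* Lower bound: the liminf condition self-improves to a neighbourhood statement,
   so if b < l(x, y), then every u has a neighbourhood on which
   f^nu_{y^nu}(., x^nu) > b for all large nu.  Tightness confines
   near-minimizers to a compact set B, over which these neighbourhoods can be
   made uniform; hence l^nu(x^nu, y^nu) >= b - e eventually.
   Upper bound: for c > l(x, y) pick u with f_y(u, x) < c; the x-part of a
   recovery sequence for f at (u, x) keeps l^nu(., y^nu) below c.  Letting c
   decrease to l(x, y), a diagonal sequence works. *)
Require Import Defs.
From HB Require Import structures.
From mathcomp Require Import all_boot all_order all_algebra.
From mathcomp Require Import all_classical all_reals all_analysis.
Import Order.TTheory GRing.Theory Num.Theory.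
Import numFieldNormedType.Exports.
Set Implicit Arguments.
Unset Strict Implicit.

Local Open Scope classical_set_scope.
Local Open Scope ring_scope.
Local Open Scope ereal_scope.

(** The separator is real even when [a] or [b] is infinite, so that inner products can later be
    moved across inequalities by finite arithmetic. *)
Lemma ereal_dense (R : realType) (a b : \bar R) :
  a < b -> exists c : R, a < c%:E /\ c%:E < b.
Proof.
case: a => [a| |] //; case: b => [b| |] //.
- rewrite lte_fin => ab; exists ((a + b) / 2)%R.
  by rewrite !lte_fin midf_lt //; split=> //; exact: (midf_lt ab).2.
- by move=> _; exists (a + 1)%R; rewrite lte_fin ltrDl ltr01 ltry.
- by move=> _; exists (b - 1)%R; rewrite lte_fin gtrDl ltrN10 ltNyr.
- by move=> _; exists 0%R; rewrite ltNyr ltry.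
Qed.

Lemma limn_esup_lt (R : realType) (u : nat -> \bar R) (c : \bar R) :
  limn_esup u < c -> \forall k \near \oo, u k < c.
Proof.
move=> /ereal_inf_lt[_ [A ooA <-]] supc.
by apply: filterS ooA => k Ak; apply: le_lt_trans supc; exact: ereal_sup_ubound.
Qed.

Lemma limn_esup_le (R : realType) (u : nat -> \bar R) (c : \bar R) :
  (\forall k \near \oo, u k <= c) -> limn_esup u <= c.
Proof.
move=> uc; apply: (@le_trans _ _ (ereal_sup (u @` [set k | u k <= c]))).
  by apply: ereal_inf_lbound; exists [set k | u k <= c].
by apply: ge_ereal_sup => _ [k kc <-].
Qed.

Lemma limn_einf_gt (R : realType) (u : nat -> \bar R) (c : \bar R) :
  c < limn_einf u -> \forall k \near \oo, c < u k.
Proof.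
rewrite /limn_einf lteNr => /limn_esup_lt; apply: filterS => k.
by rewrite lteN2.
Qed.

Lemma limn_einf_ge (R : realType) (u : nat -> \bar R) (c : \bar R) :
  (\forall k \near \oo, c <= u k) -> c <= limn_einf u.
Proof.
move=> uc; rewrite /limn_einf leeNr; apply: limn_esup_le.
by apply: filterS uc => k; rewrite leeN2.
Qed.

(** Take for [kappa nu] the largest [k <= nu] with [Q nu k]; every fixed [K] is eventually
    admissible, so [kappa] tends to infinity. *)
Lemma near_diagonal (Q : nat -> nat -> Prop) :
  (forall k, \forall nu \near \oo, Q nu k) ->
  exists2 kappa : nat -> nat, kappa @ \oo --> \oo &
    \forall nu \near \oo, Q nu (kappa nu).
Proof.
move=> Qk.
(* Admitting [0] unconditionally makes the maximum exist for every [nu]; this default is harmless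
   because [Q nu 0] holds for large [nu]. *)
pose P nu k := (k == 0)%N || `[< (k <= nu)%N /\ Q nu k >].
have exP nu : exists k, P nu k by exists 0%N.
have ubP nu k : P nu k -> (k <= nu)%N by case/orP => [/eqP->|/asboolP[]].
pose kappa nu := ex_maxn (exP nu) (ubP nu).
have kappa_ge K : \forall nu \near \oo, (K <= kappa nu)%N.
  near=> nu; rewrite /kappa; case: ex_maxnP => k _; apply.
  apply/orP; right; apply/asboolP; split.
    by near: nu; exists K.
  by near: nu; exact: Qk.
exists kappa.
  by move=> A [K _ KA]; apply: filterS (kappa_ge K) => nu; exact: KA.
near=> nu.
have : (kappa nu = 0)%N \/ Q nu (kappa nu).
  rewrite {1 2}/kappa; case: ex_maxnP => k + _.
  by case/orP => [/eqP|/asboolP[_]]; [left|right].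
by case=> // ->; near: nu; exact: Qk.
Unshelve. all: by end_near. Qed.

(** Approximate recovery at each level above [L] suffices: let the levels decrease to [L] while the
    radii shrink to [0], and diagonalise. *)
Lemma recovery_sequence (R : realType) (T : pseudoMetricType R)
    (g_ : nat -> T -> \bar R) (x : T) (L : \bar R) :
  (forall c, L < c -> exists2 x_ : nat -> T, x_ @ \oo --> x &
     \forall nu \near \oo, g_ nu (x_ nu) <= c) ->
  exists2 x_ : nat -> T, x_ @ \oo --> x &
    limn_esup (fun nu => g_ nu (x_ nu)) <= L.
Proof.
move=> Hc.
(* There is no level above [+oo], hence no minimizing sequence of levels to draw from. *)
have [->|Ly] := eqVneq L +oo.
  by exists (fun=> x); [exact: cvg_cst|rewrite leey].
have S0 : [set c | L < c] != set0.
  by apply/set0P; exists +oo; rewrite /= lt_neqAle Ly leey.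
have [c cS cL] := ereal_inf_seq S0.
have infL : ereal_inf [set c | L < c] <= L.
  rewrite leNgt; apply/negP => /ereal_dense[d [Ld]].
  by rewrite ltNge ereal_inf_lbound.
have near_ball k : \forall nu \near \oo,
    exists2 x', ball x k.+1%:R^-1 x' & g_ nu x' <= c k.
  have [x_ x_x gx_] := Hc _ (cS k).
  near=> nu; exists (x_ nu); last by near: nu.
  by near: nu; apply: (cvg_ballP _ _).1 => //; rewrite invr_gt0 ltr0n.
have [kappa kappay Qkappa] := near_diagonal near_ball.
(* For the finitely many [nu] where no suitable point is guaranteed, [x] itself may serve as a
   default. *)
have /choice[x_ x_P] : forall nu, exists x',
    (exists2 x'', ball x (kappa nu).+1%:R^-1 x'' & g_ nu x'' <= c (kappa nu)) ->
    ball x (kappa nu).+1%:R^-1 x' /\ g_ nu x' <= c (kappa nu).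
  move=> nu; have [[x' bx' gx']|H] := pselect (exists2 x'',
      ball x (kappa nu).+1%:R^-1 x'' & g_ nu x'' <= c (kappa nu)).
    by exists x'.
  by exists x => /H.
exists x_.
  apply/cvg_ballP => e e0; near=> nu.
  have [xb _] : ball x (kappa nu).+1%:R^-1 (x_ nu) /\
      g_ nu (x_ nu) <= c (kappa nu).
    by apply: x_P; near: nu.
  apply: le_ball xb; apply: ltW; near: nu.
  exact: (kappay _ (near_infty_natSinv_lt (PosNum e0))).
rewrite leNgt; apply/negP => /ereal_dense[d [Ld]]; apply/negP; rewrite -leNgt.
have cd : \forall k \near \oo, c k < d%:E.
  by apply: limn_esup_lt; rewrite (cvg_limn_einf_sup cL).2; exact: le_lt_trans Ld.
apply: limn_esup_le; near=> nu.
have [_ gc] : ball x (kappa nu).+1%:R^-1 (x_ nu) /\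
    g_ nu (x_ nu) <= c (kappa nu).
  by apply: x_P; near: nu.
apply: le_trans gc _; apply: ltW; near: nu; exact: (kappay _ cd).
Unshelve. all: by end_near. Qed.

(** Otherwise, arbitrarily close to [z] and at arbitrarily large indices, some [g_ nu] takes a value
    at most [c]. Threading such points into one sequence converging to [z] contradicts the liminf
    condition. *)
Lemma epi_liminf_near (R : realType) (T : pseudoMetricType R)
    (g_ : nat -> T -> \bar R) (g : T -> \bar R) (z : T) (c : \bar R) :
  (forall z_ : nat -> T, z_ @ \oo --> z ->
     g z <= limn_einf (fun nu => g_ nu (z_ nu))) ->
  c < g z -> \forall z' \near z & nu \near \oo, c < g_ nu z'.
Proof.
move=> liminf_g cgz; apply: contrapT => Nnear.
have /choice[p pP] : forall N, exists p : nat * T,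
    [/\ (N <= p.1)%N, ball z N.+1%:R^-1 p.2 & ~ c < g_ p.1 p.2].
  move=> N; apply: contrapT => noP; apply: Nnear.
  exists (ball z N.+1%:R^-1, [set nu | (N <= nu)%N]).
    split => /=; last by exists N.
    by apply: nbhsx_ballx; rewrite invr_gt0 ltr0n.
  move=> [z' nu] /= [bz' Nnu]; apply: contrapT => cg.
  by apply: noP; exists (nu, z').
(* Several N may share the same (p N).1 = nu; any choice still makes z_ converge,
   since a large nu forces N to be large. *)
have /choice[z_ z_P] : forall nu, exists z',
    (exists2 N, (p N).1 = nu & z' = (p N).2) \/
    ((forall N, (p N).1 <> nu) /\ z' = z).
  move=> nu; have [[N pN]|H] := pselect (exists N, (p N).1 = nu).
    by exists (p N).2; left; exists N.
  by exists z; right; split=> // N pN; apply: H; exists N.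
have z_z : z_ @ \oo --> z.
  apply/cvg_ballP => e e0.
  have [K _ Ke] := near_infty_natSinv_lt (PosNum e0).
  exists (\max_(N < K) (p N).1).+1 => // nu /= nuK.
  case: (z_P nu) => [[N pN ->]|[_ ->]]; last exact: ballxx.
  have [_ bN _] := pP N; apply: le_ball bN; apply/ltW/Ke => /=.
  rewrite leqNgt; apply/negP => NK; move: nuK; rewrite -pN ltnNge.
  by rewrite (@leq_bigmax _ (fun N : 'I_K => (p N).1) (Ordinal NK)).
have [K _ Kc] := limn_einf_gt (lt_le_trans cgz (liminf_g z_ z_z)).
(* The index [(p K).1] is at least [K], so the value of [g_] there exceeds [c]. The point of [z_] at
   that index may come from another [N], but it violates the bound just the same. *)
have [KpK _ _] := pP K.
case: (z_P (p K).1) => [[N pN zE]|[/(_ K)//]].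
by have [_ _] := pP N; apply; rewrite pN -zE; exact: Kc.
Qed.

Lemma cvg_dotp (R : realType) (m : nat) (T : Type) (F : set_system T)
    {FF : Filter F} (y_ u_ : T -> 'rV[R]_m) (y u : 'rV[R]_m) :
  y_ @ F --> y -> u_ @ F --> u ->
  dotp (y_ t) (u_ t) @[t --> F] --> dotp y u.
Proof.
move=> y_y u_u; rewrite /dotp; apply: cvg_big => [|i _].
  exact: add_continuous.
have coordi := @coord_continuous R 1 m ord0 i.
by apply: cvgM; [exact: cvg_comp y_y (coordi y)|exact: cvg_comp u_u (coordi u)].
Qed.

(** A real [c] strictly between [b + dotp y u] and [f (u, x)] separates the two limits: [f_ nu]
    stays above [c] by [epi_liminf_near], the shifted inner product below [c] by continuity. The
    joint form in [u'] and [nu] is what a compactness argument in [u] consumes. *)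
Lemma tilt_near_gt (R : realType) (m n : nat)
    (f : 'rV[R]_m * 'rV[R]_n -> \bar R)
    (f_ : nat -> 'rV[R]_m * 'rV[R]_n -> \bar R)
    (y u : 'rV[R]_m) (y_ : nat -> 'rV[R]_m)
    (x : 'rV[R]_n) (x_ : nat -> 'rV[R]_n) (b : R) :
  epi_converges f_ f -> y_ @ \oo --> y -> x_ @ \oo --> x ->
  b%:E < tilt f y (u, x) ->
  \forall u' \near u & nu \near \oo, b%:E < tilt (f_ nu) (y_ nu) (u', x_ nu).
Proof.
move=> [liminf_f _] y_y x_x b_tilt.
have /ereal_dense[c [bc cf]] : (b + dotp y u)%:E < f (u, x).
  by rewrite EFinD -lteBrDr.
have fc := epi_liminf_near (liminf_f ^~ (u, x)) cf.
have u'_u : p.1 @[p --> (nbhs u, \oo)] --> u by exact: cvg_fst.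
have nu_oo : p.2 @[p --> (nbhs u, \oo)] --> \oo by exact: cvg_snd.
have x_x' : x_ p.2 @[p --> (nbhs u, \oo)] --> x := cvg_comp _ _ nu_oo x_x.
have y_y' : y_ p.2 @[p --> (nbhs u, \oo)] --> y := cvg_comp _ _ nu_oo y_y.
have fc' : \forall u' \near u & nu \near \oo, c%:E < f_ nu (u', x_ nu).
  (* Pull [fc] back along the map sending [(u', nu)] to [((u', x_ nu), nu)]. *)
  have z'_z : (p.1, x_ p.2) @[p --> (nbhs u, \oo)] --> (u, x).
    exact: cvg_pair u'_u x_x'.
  have : ((p.1, x_ p.2), p.2) @[p --> (nbhs u, \oo)] --> (nbhs (u, x), \oo).
    exact: cvg_pair z'_z nu_oo.
  by move/(_ _ fc).
have dotpc : \forall u' \near u & nu \near \oo, (b + dotp (y_ nu) u' < c)%R.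
  have dotp_cb : (dotp y u < c - b)%R by rewrite ltrBrDl -lte_fin.
  have : \forall p \near (nbhs u, \oo), (dotp (y_ p.2) p.1 < c - b)%R.
    exact: cvgr_lt (cvg_dotp y_y' u'_u) _ dotp_cb.
  by apply: filterS => p /=; rewrite ltrBrDl.
apply: filterS2 fc' dotpc => -[u' nu] /= cf' bc'.
by rewrite /tilt lteBrDr // -EFinD; apply: lt_trans cf'; rewrite lte_fin.
Qed.

Lemma lagrangianE (R : realType) (m n : nat)
    (f : 'rV[R]_m * 'rV[R]_n -> \bar R) (x : 'rV[R]_n) (y : 'rV[R]_m) :
  lagrangian f x y = ereal_inf [set tilt f y (u, x) | u in setT].
Proof. by []. Qed.

Lemma lagrangian_liminf (R : realType) (m n : nat)
    (f : 'rV[R]_m * 'rV[R]_n -> \bar R)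
    (f_ : nat -> 'rV[R]_m * 'rV[R]_n -> \bar R)
    (y : 'rV[R]_m) (y_ : nat -> 'rV[R]_m)
    (x : 'rV[R]_n) (x_ : nat -> 'rV[R]_n) :
  epi_converges f_ f -> y_ @ \oo --> y -> x_ @ \oo --> x ->
  tight (fun nu u => tilt (f_ nu) (y_ nu) (u, x_ nu)) ->
  lagrangian f x y <= limn_einf (fun nu => lagrangian (f_ nu) (x_ nu) (y_ nu)).
Proof.
move=> f_epi y_y x_x f_tight.
rewrite leNgt; apply/negP => /ereal_dense[a [la al]].
have [b [ab bl]] := ereal_dense al.
(* The tightness tolerance is [b - a]: a lower bound [b] over [B] then leaves the lower bound [a]
   for the full infimum. *)
have ba0 : (0 < b - a)%R by rewrite subr_gt0 -lte_fin.
have [B [N [cB tightB]]] := f_tight _ ba0.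
have Bb : \forall nu \near \oo,
    B `<=` [set u | b%:E < tilt (f_ nu) (y_ nu) (u, x_ nu)].
  apply: (compact_near_coveringP B).1 => // u _.
  apply: tilt_near_gt f_epi y_y x_x _; apply: lt_le_trans bl _.
  by rewrite lagrangianE; apply: ereal_inf_lbound; exists u.
move: la; apply/negP; rewrite -leNgt; apply: limn_einf_ge; near=> nu.
have Nnu : (N <= nu)%N by near: nu; exists N.
have := tightB _ Nnu; rewrite -lagrangianE -leeBlDr // => /(le_trans _); apply.
rewrite leeBrDr // -EFinD subrKC.
apply: le_ereal_inf_tmp => _ [u Bu <-]; apply: ltW.
suff : B `<=` [set u | b%:E < tilt (f_ nu) (y_ nu) (u, x_ nu)] by exact.
by near: nu.
Unshelve. all: by end_near. Qed.

Lemma lagrangian_recovery (R : realType) (m n : nat)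
    (f : 'rV[R]_m * 'rV[R]_n -> \bar R)
    (f_ : nat -> 'rV[R]_m * 'rV[R]_n -> \bar R)
    (y : 'rV[R]_m) (y_ : nat -> 'rV[R]_m) (x : 'rV[R]_n) :
  epi_converges f_ f -> y_ @ \oo --> y ->
  exists2 x_ : nat -> 'rV[R]_n, x_ @ \oo --> x &
    limn_esup (fun nu => lagrangian (f_ nu) (x_ nu) (y_ nu)) <=
    lagrangian f x y.
Proof.
move=> [_ limsup_f] y_y.
apply: (@recovery_sequence R _ (fun nu x => lagrangian (f_ nu) x (y_ nu))).
move=> c' /ereal_dense[c [+ cc']]; rewrite lagrangianE.
move=> /ereal_inf_lt[_ [u _ <-]]; rewrite /tilt lteBlDr //= -EFinD.
(* The value [a] splits the slack: eventually [f_ nu] is below [a] at [z_ nu] and the inner product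
   is above [a - c], so the tilted value is below [c]. *)
move=> /ereal_dense[a [fa ac]].
have [z_ z_z limsup_a] := limsup_f (u, x).
have u_u : (z_ nu).1 @[nu --> \oo] --> u by exact: (cvg_comp _ _ z_z cvg_fst).
have x_x : (z_ nu).2 @[nu --> \oo] --> x by exact: (cvg_comp _ _ z_z cvg_snd).
exists (fun nu => (z_ nu).2) => //.
have f_a := limn_esup_lt (le_lt_trans limsup_a fa).
have dotpa : \forall nu \near \oo, (a - c < dotp (y_ nu) (z_ nu).1)%R.
  by apply: (cvgr_gt _ (cvg_dotp y_y u_u)); rewrite ltrBlDl -lte_fin.
apply: filterS2 f_a dotpa => nu fz_a ac_dotp.
apply: le_trans (ltW cc'); apply: (@le_trans _ _ (tilt (f_ nu) (y_ nu) (z_ nu))).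
  by apply: ereal_inf_lbound; exists (z_ nu).1 => //; case: (z_ nu).
rewrite /tilt leeBlDr //= -EFinD; apply: le_trans (ltW fz_a) _.
by rewrite lee_fin -lerBlDl ltW.
Qed.

Theorem theorem4p1 (R : realType) (m n : nat)
    (f : 'rV[R]_m * 'rV[R]_n -> \bar R)
    (f_ : nat -> 'rV[R]_m * 'rV[R]_n -> \bar R)
    (phi : 'rV[R]_n -> \bar R) (phi_ : nat -> 'rV[R]_n -> \bar R)
    (y : 'rV[R]_m) (y_ : nat -> 'rV[R]_m)
    (f_rock : rockafellian f phi)
    (f_rock_ : forall nu, rockafellian (f_ nu) (phi_ nu))
    (f_epi : epi_converges f_ f)
    (y_cvg : y_ @ \oo --> y)
    (f_tight : forall x_ : nat -> 'rV[R]_n,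
       (exists x : 'rV[R]_n, x_ @ \oo --> x) ->
       tight (fun nu u => tilt (f_ nu) (y_ nu) (u, x_ nu))) :
  epi_converges (fun nu x => lagrangian (f_ nu) x (y_ nu))
                (fun x => lagrangian f x y).
Proof.
split=> [x_ x x_x|x]; last exact: lagrangian_recovery.
by apply: lagrangian_liminf => //; apply: f_tight; exists x.
Qed.
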